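(* Let $0<d\le\infty$ and let $\mu$ be a symmetric finite positive Borel measure on $(-d,d)$ with infinite support. Let $r\ge0$ be an integer and $M_0,\dots,M_{2r+1}\ge0$. Let $\{q_n\}_{n\ge0}$ be the orthonormal polynomials with respect to $\langle p,q\rangle=\int p(x)q(x)\,d\mu(x)+\sum_{i=0}^{2r+1}M_i\,p^{(i)}(0)\,q^{(i)}(0)$, and let $\{p_n^{[4j]}\}_{n\ge0}$ be the orthonormal polynomials with respect to $x^{4j}\,d\mu(x)$. Then for each $n\ge r+1$ there exist two families of real coefficients $(\lambda_{j,n})_{j=0}^{r+1}$ and $(\lambda^*_{j,n})_{j=0}^{r+1}$, neither identically zero, such that $$q_{2n}(x)=\sum_{j=0}^{r+1}\lambda_{j,n}\,x^{2j}\,p_{2n-2j}^{[4j]}(x)$$ and $$q_{2n+1}(x)=\sum_{j=0}^{r+1}\lambda^*_{j,n}\,x^{2j}\,p_{2n+1-2j}^{[4j]}(x).$$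
   Context: All moments of $\mu$ are finite; $\mu$ symmetric means it is invariant under $x\mapsto -x$. Orthonormal polynomials are normalized with positive leading coefficients, the $n$-th one having exact degree $n$. *)

(* Defs.v *)
From HB Require Import structures.
From mathcomp Require Import all_boot all_order all_algebra.
From mathcomp Require Import all_classical all_reals all_analysis.
Set Implicit Arguments.
Unset Strict Implicit.
Unset Printing Implicit Defensive.
Import Order.TTheory GRing.Theory Num.Theory.
Import numFieldNormedType.Exports.
Local Open Scope classical_set_scope.
Local Open Scope ring_scope.

Section Definitions.
Variable R : realType.
Implicit Types (mu : {finite_measure set (measurableTypeR R) -> \bar R})
  (p q : {poly R}).

(* A Borel measure on (-d, d) is represented by a Borel measure on R that
   vanishes outside (-d, d); the endpoint d may be +oo. *)
Definition concentrated_on_sym_interval mu (d : \bar R) : Prop :=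
  mu [set x : R | ~ (- d < x%:E < d)%E] = 0%E.

Definition symmetric_measure mu : Prop :=
  forall A : set (measurableTypeR R), measurable A ->
    mu [set x : R | A (- x)] = mu A.

Definition finite_moments mu : Prop :=
  forall k : nat, mu.-integrable setT (fun x : R => (x ^+ k)%:E).

Definition measure_support mu : set R :=
  [set x : R | forall U : set R, open U -> U x -> (0 < mu U)%E].

(* The form attached to the measure x^m dmu. *)
Definition weighted_form mu (m : nat) p q : R :=
  (\int[mu]_x (p.[x] * q.[x] * x ^+ m))%R.

(* M i is the mass attached to the i-th derivative at 0, for i < s. *)
Definition sobolev_form mu (s : nat) (M : 'I_s -> R) p q : R :=
  (\int[mu]_x (p.[x] * q.[x]))%R
  + \sum_(i < s) M i * (p^`(i)).[0] * (q^`(i)).[0].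

Definition orthonormal_polynomials (B : {poly R} -> {poly R} -> R)
    (P : nat -> {poly R}) : Prop :=
  [/\ forall n, size (P n) = n.+1,
      forall n, 0 < lead_coef (P n)
    & forall m n, B (P m) (P n) = (m == n)%:R].

End Definitions.

(* Main.v *)
(* The odd moments vanish, so all the polynomials involved have the parity of
   their degree. Hence the constant (even degree) or linear (odd degree)
   coefficient of each p_m^[4j] is nonzero, and dividing out x^2 step by step
   gives, for N = 2n or N = 2n+1,
     q_N = sum_(j <= r) lam_j x^(2j) p_(N-2j)^[4j] + x^(2r+2) u.
   The derivatives at 0 of order at most 2r+1 do not see multiples of x^(2r+2),
   so q_N and every term of the sum are orthogonal for mu to the multiples of
   x^(2r+2) of degree less than N. Then so is x^(2r+2) u, which means that u is
   orthogonal for x^(4r+4) dmu to all polynomials of degree less than N-2r-2: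
   it is a multiple of p_(N-2r-2)^[4r+4]. *)
Require Import Defs.
From HB Require Import structures.
From mathcomp Require Import all_boot all_order all_algebra.
From mathcomp Require Import all_classical all_reals all_analysis.
From mathcomp Require Import zify ring lra.
Set Implicit Arguments.
Unset Strict Implicit.
Unset Printing Implicit Defensive.
Import Order.TTheory GRing.Theory Num.Theory.
Import numFieldNormedType.Exports.
Local Open Scope classical_set_scope.
Local Open Scope ring_scope.

(** * Polynomials with only even or only odd powers *)

Section PolynomialParity.
Variable R : nzRingType.
Implicit Types (f g : {poly R}) (b : bool).

Definition has_parity b f := forall i, odd i != b -> f`_i = 0.

Definition parity_part b f := \poly_(i < size f) (if odd i == b then f`_i else 0).

Lemma coef_parity_part b f i :
  (parity_part b f)`_i = if odd i == b then f`_i else 0.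
Proof.
rewrite coef_poly; case: ltnP => // lefi.
by rewrite nth_default // if_same.
Qed.

Lemma parity_part_parity b f : has_parity b (parity_part b f).
Proof. by move=> i /negPf ib; rewrite coef_parity_part ib. Qed.

Lemma parity_partD b f : f = parity_part b f + parity_part (~~ b) f.
Proof.
apply/polyP => i; rewrite coefD !coef_parity_part.
by case: (odd i); case: b; rewrite ?addr0 ?add0r.
Qed.

Lemma has_parityB b f g : has_parity b f -> has_parity b g -> has_parity b (f - g).
Proof. by move=> pf pg i ib; rewrite coefB pf // pg // subrr. Qed.

Lemma has_parityZ b (c : R) f : has_parity b f -> has_parity b (c *: f).
Proof. by move=> pf i ib; rewrite coefZ pf // mulr0. Qed.

Lemma has_parity_divX2 b f : has_parity b (f * 'X^2) -> has_parity b f.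
Proof.
move=> pf i ib; have := pf i.+2; rewrite /= negbK => /(_ ib).
by rewrite coefMXn /= subn2.
Qed.

End PolynomialParity.

Lemma poly_dvdXn (R : nzRingType) (k : nat) (f : {poly R}) :
  (forall i, (i < k)%N -> f`_i = 0) -> f = drop_poly k f * 'X^k.
Proof.
move=> f0; apply/polyP => i; rewrite coefMXn; case: ltnP => [/f0 //|ki].
by rewrite coef_drop_poly subnK.
Qed.

(** * Orthonormal polynomials of an abstract bilinear form *)

Section OrthonormalPolynomials.
Variables (R : realType) (B : {poly R} -> {scalar {poly R}}).
Implicit Types (P : nat -> {poly R}) (f g : {poly R}).

Definition even_form := forall i j, odd (i + j) -> B 'X^i 'X^j = 0.

(** Induction on [n]: subtracting a multiple of [P n] kills the coefficient of degree [n]. [B] is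
    linear by type in its second argument only, hence coefficients with [f] on the right. *)
Lemma orthonormal_expansion P n f :
  orthonormal_polynomials B P -> (size f <= n)%N ->
  f = \sum_(i < n) B (P i) f *: P i.
Proof.
case=> szP lcP onP; elim: n f => [|n IHn] f szf.
  by apply/eqP; rewrite big_ord0 -size_poly_eq0 -leqn0.
pose c := f`_n / lead_coef (P n).
have lcn0 : lead_coef (P n) != 0 by rewrite gt_eqF.
have szg : (size (f - c *: P n)%R <= n)%N.
  apply/leq_sizeP => j; rewrite leq_eqVlt => /orP[/eqP <-|ltnj].
    have lcE : lead_coef (P n) = (P n)`_n by rewrite lead_coefE szP.
    by rewrite coefB coefZ -lcE divfK ?subrr.
  by rewrite coefB coefZ !nth_default ?mulr0 ?subr0 ?szP // (leq_trans szf).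
have fE : f = c *: P n + (f - c *: P n) by rewrite addrC subrK.
have BP i :
    B (P i) f = c * (i == n)%:R + B (P i) (f - c *: P n).
  by rewrite {1}fE linearD linearZ /= onP.
(* By induction the remainder is spanned by the [P i] with i < n, so [c] is the coefficient
   [B (P n) f]. *)
have Bn : B (P n) (f - c *: P n) = 0.
  rewrite (IHn _ szg) linear_sum big1 // => i _.
  by rewrite linearZ /= onP gtn_eqF ?mulr0.
rewrite big_ord_recr /= BP Bn eqxx mulr1 addr0 {1}fE addrC; congr (_ + _).
rewrite {1}(IHn _ szg); apply: eq_bigr => i _; congr (_ *: _).
by rewrite BP ltn_eqF // mulr0 add0r.
Qed.

Lemma orthonormal_lower P n f :
  orthonormal_polynomials B P -> (size f <= n)%N -> B (P n) f = 0.
Proof.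
move=> onP szf; rewrite (orthonormal_expansion onP szf) linear_sum big1 // => i _.
by have [_ _ on] := onP; rewrite linearZ /= on gtn_eqF ?mulr0.
Qed.

Hypothesis Bsym : forall f g, B f g = B g f.

(** Parseval: [B f f] is the sum of the squares of the coefficients of [f] in the basis [P].
    Definiteness is thus read off from the orthonormal family. *)
Lemma orthonormal_definite P f :
  orthonormal_polynomials B P -> B f f = 0 -> f = 0.
Proof.
move=> onP Bff0; have fE := orthonormal_expansion onP (leqnn (size f)).
have : B f f = \sum_(i < size f) B (P i) f ^+ 2.
  rewrite {2}fE linear_sum; apply: eq_bigr => i _.
  by rewrite linearZ /= Bsym.
rewrite Bff0 => /esym/eqP; rewrite psumr_eq0; last by move=> i _; apply: sqr_ge0.
move=> /allP B0; rewrite fE big1 // => i _.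
have := B0 i (mem_index_enum i); rewrite /= sqrf_eq0 => /eqP ->.
by rewrite scale0r.
Qed.

Lemma orthonormal_unique P n f :
  orthonormal_polynomials B P -> (size f <= n.+1)%N ->
  (forall g, (size g <= n)%N -> B f g = 0) -> f = B (P n) f *: P n.
Proof.
move=> onP szf f0; rewrite {1}(orthonormal_expansion onP szf) big_ord_recr /=.
rewrite big1 ?add0r // => i _; have [szP _ _] := onP.
by rewrite Bsym f0 ?scale0r // szP.
Qed.

Lemma even_form_parity (b b' : bool) f g :
  even_form -> has_parity b f -> has_parity b' g -> b != b' -> B f g = 0.
Proof.
move=> Bev pf pg bb'; rewrite -[g]coefK poly_def linear_sum big1 // => j _.
rewrite linearZ /=; case: (eqVneq (odd j) b') => [oj|/pg ->]; last by rewrite mul0r.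
rewrite Bsym -[f]coefK poly_def linear_sum big1 ?mulr0 // => i _.
rewrite linearZ /=; case: (eqVneq (odd i) b) => [oi|/pf ->]; last by rewrite mul0r.
by rewrite Bsym Bev ?mulr0 // oddD oi oj; move: bb'; case: (b); case: (b').
Qed.

(* The part of [P n] of the wrong parity has degree less than [n], so it is
   orthogonal to [P n], hence to itself. *)
Lemma orthonormal_parity P n :
  even_form -> orthonormal_polynomials B P -> has_parity (odd n) (P n).
Proof.
move=> Bev onP i; have [szP _ _] := onP.
pose u := parity_part (odd n) (P n); pose v := parity_part (~~ odd n) (P n).
have szv : (size v <= n)%N.
  apply/leq_sizeP => j; rewrite leq_eqVlt coef_parity_part => /orP[/eqP <-|nj].
    by rewrite ifN //; case: odd.
  by rewrite [_`_j]nth_default ?if_same // szP.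
have : B (P n) v = 0 by apply: orthonormal_lower.
rewrite (parity_partD (odd n) (P n)) -/u -/v Bsym linearD /=.
rewrite [B v u](@even_form_parity (~~ odd n) (odd n)) //; last by case: odd.
- rewrite add0r => /(orthonormal_definite onP) ->; rewrite addr0.
  exact: parity_part_parity.
- exact: parity_part_parity.
- exact: parity_part_parity.
Qed.

End OrthonormalPolynomials.

(** * Forms weighted by powers of x, and the connection formula *)

(** Algebraic counterpart of [weighted_form]: [L] stands for integration against [mu]. *)
Definition power_form {R : comNzRingType} (L : {scalar {poly R}}) (m : nat) (f g : {poly R}) :=
  L (f * g * 'X^m).

Lemma power_form_is_linear (R : comNzRingType) (L : {scalar {poly R}}) m f :
  scalar (power_form L m f).
Proof.
move=> c g h; rewrite /power_form mulrDr mulrDl linearD /=.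
by rewrite -scalerAr -scalerAl linearZ.
Qed.

HB.instance Definition _ (R : comNzRingType) (L : {scalar {poly R}}) m f :=
  GRing.isLinear.Build R {poly R} R _ (power_form L m f)
    (@power_form_is_linear R L m f).

Section EvenFunctional.
Variables (R : realType) (L : {scalar {poly R}}).
Hypothesis L_odd : forall i, odd i -> L 'X^i = 0.

Lemma power_formC m f g : power_form L m f g = power_form L m g f.
Proof. by rewrite /power_form [f * g]mulrC. Qed.

Lemma power_form_even m : ~~ odd m -> even_form (power_form L m).
Proof.
by move=> om i j oij; rewrite /= /power_form -!exprD L_odd // oddD oij (negPf om).
Qed.

(* If the lowest coefficient vanished, [P n] would be [x^(e+2) g] with
   [e = odd n], and orthogonality to [x^e g] makes the norm of [x^(e+1) g]
   zero. *)
Lemma power_form_low_coef m P n :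
  ~~ odd m -> orthonormal_polynomials (power_form L m) P -> (P n)`_(odd n) != 0.
Proof.
move=> om onP; have [szP lcP _] := onP; apply/eqP => P0.
have Ppar := @orthonormal_parity _ _ (power_formC m) _ n (power_form_even om) onP.
set e : nat := odd n in P0 *.
have PE : P n = drop_poly e.+2 (P n) * 'X^(e.+2).
  apply: poly_dvdXn => i lti; case: (eqVneq (odd i) (odd n)) => [ioe|/Ppar //].
  by have -> : i = e by rewrite /e; lia.
set g := drop_poly _ _ in PE.
have g0 : g != 0.
  by apply/eqP => g0; have := lcP n; rewrite PE g0 mul0r lead_coef0 ltxx.
have szg : (size g + e.+2 = n.+1)%N.
  by rewrite -(szP n) PE size_mulXn // addnC.
have : power_form L m (P n) (g * 'X^e) = 0.
  by apply: (orthonormal_lower onP); rewrite size_mulXn //; lia.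
have -> : power_form L m (P n) (g * 'X^e) =
          power_form L m (g * 'X^(e.+1)) (g * 'X^(e.+1)).
  rewrite /power_form {1}PE; congr (L _); rewrite !exprS; ring.
move=> /(orthonormal_definite (power_formC m) onP)/eqP.
by rewrite mulf_eq0 (negPf g0) expf_eq0 polyX_eq0.
Qed.

Variable p : nat -> nat -> {poly R}.
Hypothesis p_on :
  forall j, orthonormal_polynomials (power_form L (4 * j)) (p j).

Lemma odd_mul4 j : ~~ odd (4 * j).
Proof. by rewrite oddM. Qed.

Lemma low_order_elimination (N k : nat) (Q : {poly R}) :
  (2 * k <= N)%N -> (size Q <= N.+1)%N -> has_parity (odd N) Q ->
  exists (lam : nat -> R) (u : {poly R}),
    [/\ (size u <= (N - 2 * k).+1)%N, has_parity (odd N) u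
      & Q = \sum_(j < k) lam j *: ('X^(2 * j) * p j (N - 2 * j)%N)
            + 'X^(2 * k) * u].
Proof.
move=> kN szQ parQ; elim: k kN => [_|k IHk kN].
  by exists (fun=> 0), Q; rewrite subn0 big_ord0 add0r mul1r.
have [|lam [u [szu paru QE]]] := IHk; first by lia.
set n := (N - 2 * k)%N in szu; have onN : odd n = odd N by rewrite /n; lia.
have [szp _ _] := p_on k.
have parp : has_parity (odd N) (p k n).
  rewrite -onN.
  exact: (orthonormal_parity (power_formC _) (power_form_even (odd_mul4 k)) (p_on k)).
have := power_form_low_coef n (odd_mul4 k) (p_on k); rewrite onN => pn0.
(* Read as 0 or 1, [odd N] is the least index where a polynomial of this parity can have a nonzero
   coefficient. Cancelling that coefficient makes [w] divisible by x^2. *)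
pose c := u`_(odd N) / (p k n)`_(odd N).
pose w := u - c *: p k n.
have wE : w = drop_poly 2 w * 'X^2.
  apply: poly_dvdXn => i i2; case: (eqVneq (odd i) (odd N)) => [ioN|ioN].
    have -> : i = odd N by move: i2 ioN; case: i => [|[|]]//= _ <-.
    by rewrite coefB coefZ divfK ?subrr.
  by apply: (has_parityB paru _ ioN); apply: has_parityZ.
have parw : has_parity (odd N) w by apply: has_parityB => //; apply: has_parityZ.
(* Indexing [lam] by [nat] lets it be extended at [k] without converting ordinals. *)
exists (fun j => if j == k then c else lam j), (drop_poly 2 w); split.
- rewrite size_drop_poly.
  have : (size w <= n.+1)%N.
    rewrite (leq_trans (size_polyD _ _)) // geq_max szu size_polyN.
    by rewrite (leq_trans (size_scale_leq _ _)) // szp.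
  by rewrite /n; lia.
- by apply: has_parity_divX2; rewrite -wE.
- rewrite {1}QE big_ord_recr /= eqxx -addrA; congr (_ + _).
    by apply: eq_bigr => j _; rewrite ltn_eqF.
  have -> : 'X^(2 * k.+1) * drop_poly 2 w = 'X^(2 * k) * w.
    by rewrite {2}wE mulnS addnC exprD -mulrA ['X^2 * _]mulrC.
  by rewrite /w -/n mulrBr -scalerAr addrC subrK.
Qed.

(** The last hypothesis is what remains of the orthogonality of [q N] when it is tested on multiples
    of x^(2k), where 2k is the number of masses: the mass terms vanish there and only [L] is
    left. *)
Lemma connection_formula (N k : nat) (Q : {poly R}) :
  (2 * k <= N)%N -> (size Q <= N.+1)%N -> has_parity (odd N) Q -> Q != 0 ->
  (forall g : {poly R}, (size g + 2 * k <= N)%N -> L (Q * ('X^(2 * k) * g)) = 0) ->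
  exists lam : 'I_k.+1 -> R,
    (exists j, lam j != 0) /\
    Q = \sum_(j < k.+1) lam j *: ('X^(2 * j) * p j (N - 2 * j)%N).
Proof.
move=> kN szQ parQ Q0 orthQ.
have [lam [u [szu paru QE]]] := low_order_elimination kN szQ parQ.
have uE : u = power_form L (4 * k) (p k (N - 2 * k)%N) u *: p k (N - 2 * k)%N.
  apply: (orthonormal_unique (power_formC _) (p_on k) szu) => g szg.
  have /orthQ : (size g + 2 * k <= N)%N by lia.
  rewrite {1}QE mulrDl linearD /= mulr_suml linear_sum big1 ?add0r => [|j _].
    move=> <-; rewrite /power_form; congr (L _).
    have -> : (4 * k = 2 * k + 2 * k)%N by lia.
    by rewrite exprD; ring.
  rewrite -scalerAl linearZ /=.
  (* Moving x^(2j) from x^(2k) to the weight, where it joins the factor x^(2j) of the term, produces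
     x^(4j). What remains, x^(2(k-j)) g, has size at most N - 2j, so [p j (N - 2 * j)] is orthogonal
     to it. *)
  have <- : power_form L (4 * j) (p j (N - 2 * j)%N) ('X^(2 * (k - j)) * g) =
         L ('X^(2 * j) * p j (N - 2 * j)%N * ('X^(2 * k) * g)).
    rewrite /power_form; congr (L _).
    have -> : (2 * k = 2 * (k - j) + 2 * j)%N by have := ltn_ord j; lia.
    have -> : (4 * j = 2 * j + 2 * j)%N by lia.
    by rewrite !exprD; ring.
  rewrite (orthonormal_lower (p_on j)) ?mulr0 //.
  rewrite mulrC (leq_trans (size_polyMleq _ _)) // size_polyXn.
  by have := ltn_ord j; lia.
set c := power_form _ _ _ _ in uE.
pose lam' (j : 'I_k.+1) := if j == k :> nat then c else lam j.
have QE' : Q = \sum_(j < k.+1) lam' j *: ('X^(2 * j) * p j (N - 2 * j)%N).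
  rewrite big_ord_recr /= {1}QE {1}uE /lam' eqxx -scalerAr; congr (_ + _).
  by apply: eq_bigr => j _; rewrite /= ltn_eqF.
(* If all coefficients vanished, so would [Q]. *)
exists lam'; split => //; apply/existsP; apply: contraNT Q0.
rewrite negb_exists => /forallP lam0; rewrite QE' big1 // => j _.
by have := lam0 j; rewrite negbK => /eqP ->; rewrite scale0r.
Qed.

End EvenFunctional.

(** * Forms with derivative masses at 0 *)

Definition derivative_form {R : comNzRingType} (L : {scalar {poly R}}) (s : nat)
    (M : 'I_s -> R) (f g : {poly R}) :=
  L (f * g) + \sum_(i < s) M i * (f^`(i)).[0] * (g^`(i)).[0].

Lemma derivative_form_is_linear (R : comNzRingType) (L : {scalar {poly R}}) s
    (M : 'I_s -> R) f :
  scalar (derivative_form L M f).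
Proof.
move=> c g h; rewrite /derivative_form mulrDr -scalerAr linearD linearZ /=.
rewrite mulrDr addrACA; congr (_ + _).
rewrite big_distrr -big_split; apply: eq_bigr => i _ /=.
by rewrite linearD linearZ hornerD hornerZ /=; ring.
Qed.

HB.instance Definition _ (R : comNzRingType) (L : {scalar {poly R}}) s
    (M : 'I_s -> R) f :=
  GRing.isLinear.Build R {poly R} R _ (derivative_form L M f)
    (@derivative_form_is_linear R L s M f).

Lemma derivative_formC (R : comNzRingType) (L : {scalar {poly R}}) s
    (M : 'I_s -> R) f g :
  derivative_form L M f g = derivative_form L M g f.
Proof.
rewrite /derivative_form mulrC; congr (_ + _).
by apply: eq_bigr => i _; rewrite mulrAC.
Qed.

Lemma derivn_at0 (R : nzSemiRingType) (f : {poly R}) i : (f^`(i)).[0] = f`_i *+ i`!.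
Proof. by rewrite horner_coef0 coef_derivn addn0 ffactnn. Qed.

(** The mass terms are diagonal on monomials: the term of index k can be nonzero only if i = j = k,
    which makes i + j even. *)
Lemma derivative_form_even (R : realType) (L : {scalar {poly R}}) s
    (M : 'I_s -> R) :
  (forall i, odd i -> L 'X^i = 0) -> even_form (derivative_form L M).
Proof.
move=> L_odd i j oij; rewrite /= /derivative_form -exprD L_odd // add0r.
rewrite big1 // => k _; rewrite !derivn_at0 !coefXn.
case: (eqVneq (k : nat) i) => [ki|_]; last by rewrite mul0rn mulr0 mul0r.
case: (eqVneq (k : nat) j) => [kj|_]; last by rewrite mul0rn mulr0.
by move: oij; rewrite -ki -kj addnn odd_double.
Qed.

(** * Integration of polynomials against [mu] *)

Section Integral.
Variables (R : realType) (mu : {finite_measure set (measurableTypeR R) -> \bar R}).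
Hypothesis mu_mom : finite_moments mu.

Lemma integrable_horner (f : {poly R}) :
  mu.-integrable setT (fun x : R => (f.[x])%:E).
Proof.
under eq_fun do rewrite horner_coef -sumEFin.
apply: integrable_sum => //= i _.
under eq_fun do rewrite EFinM.
exact: integrableZl.
Qed.

(** Bundling the integral as a linear functional makes the algebraic results above applicable to
    [mu]. *)
Lemma horner_integral_functional :
  exists L : {scalar {poly R}}, forall f, L f = (\int[mu]_x f.[x])%R.
Proof.
pose I (f : {poly R}) := (\int[mu]_x f.[x])%R.
have I_lin : scalar I.
  move=> c f g; rewrite /I.
  under eq_Rintegral do rewrite hornerD hornerZ.
  rewrite RintegralD ?RintegralZl //; try exact: integrable_horner.
  under eq_fun do rewrite -hornerZ.
  exact: integrable_horner.
pose L : {scalar {poly R}} := HB.pack I (GRing.isLinear.Build R {poly R} R _ I I_lin).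
by exists L.
Qed.

Hypothesis mu_sym : symmetric_measure mu.

(** The substitution of -x for x preserves [mu] and changes the sign of the integrand, so the finite
    integral equals its opposite. *)
Lemma odd_moment i : odd i -> (\int[mu]_x (x ^+ i))%R = 0.
Proof.
move=> oi; pose opp : measurableTypeR R -> measurableTypeR R := -%R.
have mN : measurable_fun setT opp by rewrite /opp.
have /integrableP[mX _] := mu_mom i.
have NX : (fun x => (x ^+ i)%:E) \o opp = (fun x : measurableTypeR R => (- 1)%:E * (x ^+ i)%:E)%E.
  by apply/funext => x /=; rewrite -EFinM exprNn -signr_odd oi expr1.
have : (\int[mu]_x (x ^+ i)%:E = \int[pushforward mu opp]_x (x ^+ i)%:E)%E.
  apply: eq_measure_integral => A mA _. exact/esym/mu_sym.
rewrite integral_pushforward // preimage_setT ?NX; last first.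
  exact: integrableZl.
rewrite integralZl //.
move=> muE; rewrite /Rintegral.
have := integrable_fin_num measurableT (mu_mom i).
move: muE; case: (X in fine X) => [x|//|//]; rewrite -EFinM => -[] /=.
move=> xE _; lra.
Qed.

End Integral.

(** * Specialization to the measure *)

Unset Implicit Arguments.

Theorem theorem3 (R : realType) (d : \bar R) (d_gt0 : (0 < d)%E)
    (mu : {finite_measure set (measurableTypeR R) -> \bar R})
    (mu_conc : concentrated_on_sym_interval mu d)
    (mu_sym : symmetric_measure mu)
    (mu_supp : infinite_set (measure_support mu))
    (mu_mom : finite_moments mu)
    (r : nat) (M : 'I_(2 * r + 2) -> R) (M_ge0 : forall i, 0 <= M i)
    (q : nat -> {poly R})
    (q_on : orthonormal_polynomials (sobolev_form mu M) q)
    (p : nat -> nat -> {poly R}) (* p j n is the polynomial p_n^[4j] *)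
    (p_on : forall j, orthonormal_polynomials (weighted_form mu (4 * j)) (p j)) :
  forall n : nat, (r + 1 <= n)%N ->
    exists lam lam' : 'I_(r + 2) -> R,
      [/\ exists j, lam j != 0,
          exists j, lam' j != 0,
          q (2 * n)%N =
            \sum_(j < r + 2) lam j *: ('X^(2 * j) * p j (2 * n - 2 * j)%N)
        & q (2 * n + 1)%N =
            \sum_(j < r + 2) lam' j *: ('X^(2 * j) * p j (2 * n + 1 - 2 * j)%N)].
Proof.
have [L LE] := horner_integral_functional mu_mom.
have L_odd i : odd i -> L 'X^i = 0.
  move=> oi; rewrite LE -(odd_moment mu_mom mu_sym oi).
  by under eq_Rintegral do rewrite hornerXn.
have pL_on j : orthonormal_polynomials (power_form L (4 * j)) (p j).
  have [szp lcp on] := p_on j; split => // m n; rewrite -on /power_form LE.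
  by under eq_Rintegral do rewrite !hornerM hornerXn.
have qL_on : orthonormal_polynomials (derivative_form L M) q.
  have [szq lcq on] := q_on; split => // m n; rewrite -on /derivative_form LE.
  by under eq_Rintegral do rewrite hornerM.
(* Both parities are the connection formula with k = r + 1, taken at N = 2n and at N = 2n + 1. *)
have qE N : (2 * r.+1 <= N)%N -> exists lam : 'I_r.+2 -> R,
    (exists j, lam j != 0) /\
    q N = \sum_(j < r.+2) lam j *: ('X^(2 * j) * p j (N - 2 * j)%N).
  have [szq lcq _] := q_on => rN.
  apply: (connection_formula L_odd pL_on) => //; first by rewrite szq.
  - exact: (orthonormal_parity (derivative_formC _ _)
      (derivative_form_even _ L_odd) qL_on).
  - by rewrite -lead_coef_eq0 gt_eqF.
  move=> g szg.
  have : derivative_form L M (q N) ('X^(2 * r.+1) * g) = 0.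
    apply: (orthonormal_lower qL_on).
    by rewrite (leq_trans (size_polyMleq _ _)) // size_polyXn; lia.
  (* Every mass index satisfies i < 2r + 2, so the i-th derivative of x^(2r+2) g vanishes at 0. *)
  rewrite /derivative_form [X in _ + X]big1 ?addr0 // => i _.
  rewrite [X in _ * X]derivn_at0 coefXnM ifT ?mul0rn ?mulr0 //.
  by have := ltn_ord i; lia.
move=> n rn; rewrite addn2.
have [|lam [lam0 lamE]] := qE (2 * n)%N; first by lia.
have [|lam' [lam'0 lam'E]] := qE (2 * n + 1)%N; first by lia.
by exists lam, lam'; split.
Qed.
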